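(* Let $\alpha=\frac{2}{3}\pi$ and let $\alpha,\beta,\gamma,\delta,\epsilon$ denote distinct angles. Then a spherical tiling by $12$ angle congruent pentagons must have one of the following (unordered) angle combinations: 1. $\alpha^5$: the angles in the pentagon are $\alpha,\alpha,\alpha,\alpha,\alpha$. The anglewise vertex combination is $\{20\alpha^3\}$. 2. $\alpha^3\beta\gamma$: the angles in the pentagon are $\alpha,\alpha,\alpha,\beta,\gamma$, satisfying $\beta+\gamma=2\alpha$. The anglewise vertex combination is $\{8\alpha^3,12\alpha\beta\gamma\}$. 3. $\alpha^2\beta^2\gamma$: the angles in the pentagon are $\alpha,\alpha,\beta,\beta,\gamma$, satisfying $2\beta+\gamma=3\alpha$. The anglewise vertex combination is $\{8\alpha^3,12\beta^2\gamma\}$. 4. $\alpha^2\beta\gamma\delta$: the angles in the pentagon are $\alpha,\alpha,\beta,\gamma,\delta$, satisfying $\beta+\gamma+\delta=3\alpha$. The anglewise vertex combination is $\{8\alpha^3,12\beta\gamma\delta\}$. 5. $\alpha\beta\gamma\delta\epsilon$: the angles in the pentagon are $\alpha,\beta,\gamma,\delta,\epsilon$, satisfying $\gamma=3\alpha-2\beta$, $\delta=2\alpha-\beta$, $\epsilon=2\beta-\alpha$. There are three possible anglewise vertex combinations: $\{4\alpha\beta\delta,8\alpha\gamma\epsilon,4\beta^2\gamma,4\delta^2\epsilon\}$, $\{\alpha^3,2\alpha\beta\delta,7\alpha\gamma\epsilon,5\beta^2\gamma,5\delta^2\epsilon\}$, $\{2\alpha^3,6\alpha\gamma\epsilon,6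\beta^2\gamma,6\delta^2\epsilon\}$.
   Context: A spherical tiling is given by a finite connected graph nicely embedded in $S^2$ (edges may be nice curves, not necessarily great arcs) with all vertices of degree $\ge 3$; here all $12$ tiles are pentagons (five edges, enclosed by a simple closed curve). The angles of the tiles at each vertex sum to $2\pi$. Two polygons are angle congruent if there is a correspondence between their edges that preserves adjacency of edges and preserves the angles between adjacent edges; in a tiling by angle congruent pentagons any two tiles are angle congruent. A vertex is named by the multiset of angles at it: e.g. an $\alpha\beta\gamma$-vertex is a degree $3$ vertex at which the three angles are $\alpha,\beta,\gamma$, and a $\beta^2\gamma$-vertex one with angles $\beta,\beta,\gamma$. The anglewise vertex combination lists all vertices of the tiling with multiplicity: $\{8\alpha^3,12\beta\gamma\delta\}$ means that the tiling has exactly $8$ $\alpha^3$-vertices and $12$ $\beta\gamma\delta$-vertices and no others. The letters other than $\alpha$ are names that may be assigned suitably to the angles of the pentagon. *)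

(* Defs.v *)
From HB Require Import structures.
From mathcomp Require Import all_boot all_order all_algebra all_fingroup.
From mathcomp Require Import reals trigo.

Set Implicit Arguments.
Unset Strict Implicit.
Unset Printing Implicit Defensive.

Import Order.TTheory GRing.Theory Num.Theory.
Local Open Scope ring_scope.

(* A graph embedded in S^2, up to homeomorphism, is given by its rotation
   system on the set of darts (oriented edges): [opp x] is the reverse of the
   dart x, and [rot x] is the dart following x counterclockwise around the
   initial vertex of x. The vertices and the edges are the cycles of [rot] and
   of [opp]. The tile on the left of x is the cycle of x under the boundary
   walk rot^-1 o opp: arriving at the end of x along x, it leaves by the
   next dart clockwise from [opp x]. The surface carrying the graph is S^2 iff
   the graph is connected and V - E + F = 2.
     [angle x] is the angle, in the tile on the left of x, at the initial vertex
   of x; it lies between x and [rot x], which carry two consecutive edges of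
   that tile. As edges may be arbitrary curves, the only constraint
   relating the angles to one another is their sum at each vertex. *)
Record spherical_tiling (R : realType) := SphericalTiling {
  dart : finType;
  opp : {perm dart};
  rot : {perm dart};
  angle : dart -> R;
  oppK : forall x, opp (opp x) = x;
  opp_neq : forall x, opp x != x;
  tiling_connected :
    forall x y, connect [rel u v | (v == opp u) || (v == rot u)] x y;
  tiling_euler :
    (#|porbits rot| + #|porbits (opp * rot^-1)%g| = #|porbits opp| + 2)%N;
  degree_ge3 : forall V, V \in porbits rot -> (3 <= #|V|)%N;
  angle_sum : forall V, V \in porbits rot -> \sum_(x in V) angle x = 2 * pi
}.

Section Tilings.
Variables (R : realType) (T : spherical_tiling R).

Definition next : {perm dart T} := (opp T * (rot T)^-1)%g.

Definition vertices : {set {set dart T}} := porbits (rot T).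

Definition tiles : {set {set dart T}} := porbits next.

(* The boundary walk of F is a simple closed curve with five edges: it has five
   darts, and they start at five different vertices. *)
Definition pentagon (F : {set dart T}) : Prop :=
  #|F| = 5%N /\ {in F &, injective (porbit (rot T))}.

(* The edges x and y of a tile are adjacent, and t is the angle between them. *)
Definition edges_meet (x y : dart T) (t : R) : Prop :=
  (y = next x /\ t = angle y) \/ (x = next y /\ t = angle x).

Definition angle_congruent (F G : {set dart T}) : Prop :=
  exists phi : dart T -> dart T,
    [/\ {in F &, injective phi},
        phi @: F = G &
        {in F &, forall x y, forall t,
           edges_meet x y t <-> edges_meet (phi x) (phi y) t}].

(* Multisets of angles are represented by sequences up to permutation. The set
   A of darts is a tile (giving the angles in the tile) or a vertex (giving the
   angles around it). *)
Definition has_angles (A : {set dart T}) (s : seq R) : bool :=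
  perm_eq [seq angle x | x <- enum A] s.

Definition tile_angles (s : seq R) : Prop :=
  forall F, F \in tiles -> has_angles F s.

(* For every item (n, s) of l there are exactly n vertices with angles s, and
   there are no other vertices. *)
Definition vertex_combination (l : seq (nat * seq R)) : Prop :=
  (forall p, p \in l -> #|[set V in vertices | has_angles V p.2]| = p.1) /\
  (forall V, V \in vertices -> exists2 p, p \in l & has_angles V p.2).

End Tilings.

(* Main.v *)
Require Import Defs.
From HB Require Import structures.
From mathcomp Require Import all_boot all_order all_algebra all_fingroup.
From mathcomp Require Import reals trigo.
From mathcomp Require Import zify ring lra.

Set Implicit Arguments.
Unset Strict Implicit.
Unset Printing Implicit Defensive.

Import Order.TTheory GRing.Theory Num.Theory.
Local Open Scope ring_scope.

(** Only counting is needed: Euler's formula gives 20 vertices, all of degree 3,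
    and all tiles have the same multiset t of five angles, so the angles at the
    vertices form 20 triples of sum 3a which together use 12 copies of t.
    Averaging a linear combination of numbers of angles of given kinds over the
    20 triples forces triples of a given shape to exist. A triple has the signs
    (0,0,0), (-,0,+), (-,+,+) or (-,-,+) relative to a, so t has at most twice
    as many angles on one side of a as on the other. Sorting t leaves few sign
    patterns; the one without a is contradictory, the one with a single a is
    a-2u, a-u, a, a+u, a+2u, and the numbers of triples of each kind then solve
    a linear system. *)

(** * Counting darts *)

Lemma sum_porbits (D : finType) (s : {perm D}) (F : D -> nat) :
  (\sum_(A in porbits s) \sum_(x in A) F x = \sum_x F x)%N.
Proof.
rewrite (partition_big_imset (porbit s)) /=.
apply: eq_bigr => _ /imsetP[y _ ->]; apply: eq_bigl => x.
by rewrite eq_porbit_mem.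
Qed.

Lemma card_porbits (D : finType) (s : {perm D}) k :
  (forall A, A \in porbits s -> #|A| = k) -> #|D| = (#|porbits s| * k)%N.
Proof.
move=> cardA; have <- : (\sum_(x : D) 1)%N = #|D| by rewrite sum1_card.
rewrite -(sum_porbits s (fun=> 1%N)) -sum_nat_const.
by apply: eq_bigr => A /cardA <-; rewrite sum1_card.
Qed.

Lemma count_map_enum (D : finType) (U : Type) (f : D -> U) (P : pred U)
    (A : {set D}) :
  count P [seq f x | x <- enum A] = (\sum_(x in A) P (f x))%N.
Proof. by rewrite count_map -sum1_count big_mkcond big_enum. Qed.

Lemma card_porbit_involution (D : finType) (s : {perm D}) x :
  s (s x) = x -> s x != x -> #|porbit s x| = 2%N.
Proof.
move=> sK s_neq; have -> : porbit s x = [set x; s x]; last first.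
  by rewrite cards2 eq_sym s_neq.
apply/setP => y; rewrite !inE; apply/porbitP/orP.
  case=> i ->; rewrite permX; elim: i => [|i [] /eqP /= ->]; first by left.
    by right.
  by left; rewrite sK.
case=> /eqP ->; first by exists 0%N; rewrite expg0 perm1.
by exists 1%N; rewrite expg1.
Qed.

(** * Angle congruent tiles and vertex degrees *)

Section Tiling.
Variables (R : realType) (T : spherical_tiling R).

Lemma next_tile F x : F \in tiles T -> (Defs.next T x \in F) = (x \in F).
Proof.
case/imsetP=> y _ ->; rewrite -!eq_porbit_mem.
by have := porbit_perm (Defs.next T) 1 x; rewrite expg1 => ->.
Qed.

Lemma next_next_neq F x :
  F \in tiles T -> (2 < #|F|)%N -> x \in F -> Defs.next T (Defs.next T x) != x.
Proof.
case/imsetP=> y _ -> cardF; rewrite -eq_porbit_mem => /eqP eqxy.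
apply: contraTneq cardF => nextK; rewrite -eqxy -leqNgt.
have [/eqP next1|next1] := boolP (Defs.next T x == x).
  by rewrite (@leq_trans 1) //; have := uniq_traject_porbit (Defs.next T) x;
    case: #|_| => [|[|n]] //=; rewrite inE next1 eqxx.
by rewrite card_porbit_involution.
Qed.

(** [phi] may keep or reverse the orientation, and this is handled dart by dart: [psi] sends [x] to
    a dart of [G] that carries the angle at [next x]. It is a bijection from [F] to [G], and [next]
    permutes [F], so the multisets agree. *)
Lemma angle_congruent_perm F G : F \in tiles T -> G \in tiles T ->
  (2 < #|F|)%N -> #|G| = #|F| -> angle_congruent F G ->
  perm_eq [seq angle x | x <- enum F] [seq angle x | x <- enum G].
Proof.
move=> tileF tileG cardF cardG [phi [phi_inj phiF phi_meet]].
have nextF x : x \in F -> Defs.next T x \in F by rewrite next_tile.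
have meet x : x \in F ->
    phi (Defs.next T x) = Defs.next T (phi x) /\ angle (phi (Defs.next T x)) = angle (Defs.next T x)
    \/ phi x = Defs.next T (phi (Defs.next T x)) /\ angle (phi x) = angle (Defs.next T x).
  move=> Fx; have := phi_meet _ _ Fx (nextF _ Fx) (angle (Defs.next T x)).
  by case=> /(_ (or_introl (conj erefl erefl))) [] [-> ->] _; [left|right].
have phiG x : x \in F -> phi x \in G by move=> Fx; rewrite -phiF imset_f.
have neqG x : x \in G -> Defs.next T (Defs.next T x) != x.
  by apply: next_next_neq; rewrite ?cardG.
(* The angle at next x is the one between x and next x; it is found in G
   between phi x and phi (next x), at whichever of them comes second. *)
pose psi x := if phi (Defs.next T x) == Defs.next T (phi x) then phi (Defs.next T x) else phi x.
have psi_angle x : x \in F -> angle (psi x) = angle (Defs.next T x).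
  move=> Fx; rewrite /psi; case: eqP => [eq1|neq1].
    case: (meet x Fx) => -[] // eq2 _.
    by have := neqG _ (phiG x Fx); rewrite -eq1 -eq2 eqxx.
  by case: (meet x Fx) => -[].
(* A change of orientation would fold the tile: [phi (next x) = phi y] gives [y = next x], and then
   [next (next x) = x]. *)
have mixed x y : x \in F -> y \in F -> phi (Defs.next T x) = Defs.next T (phi x) ->
    phi (Defs.next T y) != Defs.next T (phi y) -> phi (Defs.next T x) != phi y.
  move=> Fx Fy eq_x neq_y; apply/eqP => /phi_inj => /(_ (nextF _ Fx) Fy) eq_xy.
  case: (meet y Fy) => -[eq_y _]; first by rewrite eq_y eqxx in neq_y.
  have /eqP := next_next_neq tileF cardF Fx; apply.
  rewrite eq_xy; apply/phi_inj; rewrite ?nextF //; apply/(@perm_inj _ (Defs.next T)).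
  by rewrite -eq_y -eq_xy eq_x.
have psi_inj : {in F &, injective psi}.
  move=> x y Fx Fy; rewrite /psi.
  case: eqP => [eq_x|/eqP neq_x]; case: eqP => [eq_y|/eqP neq_y] eq_xy.
  - by apply/(@perm_inj _ (Defs.next T))/phi_inj; rewrite ?nextF.
  - by have := mixed x y Fx Fy eq_x neq_y; rewrite eq_xy eqxx.
  - by have := mixed y x Fy Fx eq_y neq_x; rewrite eq_xy eqxx.
  - exact: phi_inj.
have psiF : psi @: F = G.
  apply/eqP; rewrite eqEcard card_in_imset // cardG leqnn andbT.
  by apply/subsetP=> _ /imsetP[x Fx ->]; rewrite /psi; case: ifP => _; rewrite phiG ?nextF.
have nextFF : Defs.next T @: F = F.
  apply/eqP; rewrite eqEcard card_imset ?leqnn ?andbT; last exact: perm_inj.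
  by apply/subsetP=> _ /imsetP[x Fx ->]; rewrite nextF.
apply/seq.permP => P; rewrite !count_map_enum -{1}nextFF -psiF !big_imset //=.
  by apply: eq_bigr => x Fx; rewrite psi_angle.
by move=> x y _ _; apply: perm_inj.
Qed.

Hypotheses (tiles12 : #|tiles T| = 12%N)
           (card_tile : forall F, F \in tiles T -> #|F| = 5%N).

Lemma card_darts : #|dart T| = 60%N.
Proof. by rewrite (card_porbits card_tile) -/(tiles T) tiles12. Qed.

(** The 60 darts form 30 edges, and Euler's formula leaves 30 + 2 - 12 vertices. *)
Lemma card_vertices : #|vertices T| = 20%N.
Proof.
have card_edge E : E \in porbits (Defs.opp T) -> #|E| = 2%N.
  by case/imsetP=> x _ ->; rewrite card_porbit_involution ?oppK ?opp_neq.
have euler : (#|vertices T| + #|tiles T| = #|porbits (Defs.opp T)| + 2)%N.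
  exact: tiling_euler.
have := card_porbits card_edge; rewrite card_darts; lia.
Qed.

(** Twenty degrees, each at least 3, add up to the 60 darts, so none can exceed 3. *)
Lemma degree_3 V : V \in vertices T -> #|V| = 3%N.
Proof.
have sum_deg : (\sum_(A in vertices T) #|A| = \sum_(A in vertices T) 3)%N.
  rewrite sum_nat_const card_vertices -[RHS]card_darts -[RHS]sum1_card.
  rewrite -(sum_porbits (Defs.rot T) (fun=> 1%N)).
  by apply: eq_bigr => A _; rewrite sum1_card.
move=> vV; apply/eqP; apply: contra_eqT sum_deg => neq3.
rewrite gtn_eqF // (bigD1 V) // [X in (_ < X)%N](bigD1 V) //= -addSn.
apply: leq_add; first by rewrite ltn_neqAle eq_sym neq3 degree_ge3.
by apply: leq_sum => A /andP[vA _]; apply: degree_ge3.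
Qed.

End Tiling.

(** * Triples of angles of given sum *)

(** Only the choices that agree with the linear facts in the context survive. *)
Ltac cases_in H :=
  rewrite !inE in H; repeat (case/orP: H => H); move/eqP: H => H; try lra.

Ltac perm_cases :=
  let P := fresh "P" in apply/seq.permP; intro P; rewrite /=;
  repeat match goal with |- context [P ?x] => case: (P x) end; done.

Section AngleSystems.
Variable R : realFieldType.
Implicit Types (a : R) (t : seq R) (vs : seq (seq R)).

(** All that is kept of the tiling: [t] lists the angles of a tile, [vs] those around each vertex.
    Leaving [a] arbitrary makes the notion stable under negation of all angles. *)
Definition angle_system a t vs : Prop :=
  [/\ size t = 5%N,
      forall v, v \in vs -> size v = 3%N /\ \sum_(x <- v) x = 3 * a &
      perm_eq (flatten vs) (flatten (nseq 12 t))].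

Definition multiplicity vs (s : seq R) : nat := count (perm_eq^~ s) vs.

Definition vertex_counts vs (l : seq (nat * seq R)) : Prop :=
  (forall p, p \in l -> multiplicity vs p.2 = p.1) /\
  (forall v, v \in vs -> exists2 p, p \in l & perm_eq v p.2).

Lemma angle_system_perm a t t' vs :
  perm_eq t t' -> angle_system a t vs -> angle_system a t' vs.
Proof.
move=> tt' [size_t Hv flat]; split=> //; first by rewrite -(perm_size tt').
apply: perm_trans flat _; apply/seq.permP => P.
by rewrite !count_flatten !map_nseq (seq.permP tt' P).
Qed.

(** Negation exchanges the angles below and above [a], which reduces the pattern with three below
    and two above to its mirror image. *)
Lemma angle_system_opp a t vs :
  angle_system a t vs ->
  angle_system (- a) (map -%R t) [seq map -%R v | v <- vs].
Proof.
case=> size_t Hv flat; split; first by rewrite size_map.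
  move=> _ /mapP[v /Hv[size_v sum_v] ->]; rewrite size_map; split=> //.
  by rewrite big_map sumrN sum_v mulrN.
by rewrite -map_flatten -map_nseq -map_flatten perm_map.
Qed.

Section System.
Variables (a : R) (t : seq R) (vs : seq (seq R)).
Hypothesis system : angle_system a t vs.

Lemma sum_count (P : pred R) : (\sum_(v <- vs) count P v = 12 * count P t)%N.
Proof.
case: system => _ _ /seq.permP/(_ P); rewrite !count_flatten => flat.
by rewrite -(big_map (count P) xpredT id) -sumnE flat map_nseq sumn_nseq mulnC.
Qed.

(** The 20 triples add up to [60 * a], and they use 12 copies of [t]. *)
Lemma system_sum : \sum_(x <- t) x = 5 * a.
Proof.
case: system => size_t Hv flat.
have size_vs : size vs = 20%N.
  have := sum_count predT; rewrite count_predT size_t.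
  rewrite (eq_big_seq (fun=> 3%N)); last by move=> v /Hv[size_v _]; rewrite count_predT.
  rewrite big_const_seq iter_addn_0 count_predT mulnC => size3.
  by apply/eqP; rewrite -(eqn_pmul2r (isT : 0 < 3)%N) size3.
have sum_vs : \sum_(x <- flatten vs) x = 60 * a.
  rewrite big_flatten; under eq_big_seq => v /Hv[_ ->] do over.
  by rewrite big_const_seq count_predT size_vs iter_addr_0 -mulr_natl; ring.
move: sum_vs; rewrite (perm_big _ flat) big_flatten big_nseq iter_addr_0 -mulr_natl; lra.
Qed.

Lemma vertexP v : v \in vs -> exists x y z,
  [/\ perm_eq v [:: x; y; z], [/\ x \in t, y \in t & z \in t],
      x <= y, y <= z & x + y + z = 3 * a].
Proof.
case: system => size_t Hv flat vsv; have [] := Hv v vsv.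
have v_sort : perm_eq v (sort <=%R v) by rewrite perm_sym perm_sort.
have : {subset sort <=%R v <= t}.
  move=> x; rewrite mem_sort => vx.
  have : x \in flatten vs by apply/flattenP; exists v.
  by rewrite (perm_mem flat) => /flattenP[s]; rewrite mem_nseq => /eqP->.
rewrite (perm_size v_sort) (perm_big _ v_sort) /=.
have := sort_le_sorted v; move: v_sort.
case: (sort _ _) => [|x [|y [|z [|? ?]]]] //= v_xyz /and3P[xy yz _] sub _.
rewrite !big_cons big_nil addr0 addrA => sum3.
by exists x, y, z; split=> //; split; rewrite sub ?inE ?eqxx ?orbT.
Qed.

(* If every triple satisfied the opposite inequality, so would t: the triples
   use 12 copies of t. *)
Lemma averaging (P Q S U : pred R) i j k l :
  (i * count P t + j * count Q t < k * count S t + l * count U t)%N ->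
  exists2 v, v \in vs &
    (i * count P v + j * count Q v < k * count S v + l * count U v)%N.
Proof.
move=> lt_t; apply/hasP/negPn/negP => /hasPn le_v.
have : (\sum_(v <- vs) (k * count S v + l * count U v)
    <= \sum_(v <- vs) (i * count P v + j * count Q v))%N.
  rewrite big_seq [X in (_ <= X)%N]big_seq; apply: leq_sum => v /le_v /=.
  by rewrite -leqNgt.
rewrite !big_split /= -!big_distrr /= !sum_count; lia.
Qed.

Lemma mem_vertex x : x \in t -> exists2 v, v \in vs & x \in v.
Proof.
case: system => _ _ flat tx; have : x \in flatten vs; last by case/flattenP=> v; exists v.
by rewrite (perm_mem flat) mem_cat tx.
Qed.

(** Serves to refute candidates for [t]: an angle that fits into no triple of sum [3 * a] cannot
    occur. *)
Lemma mates x : x \in t ->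
  exists y z, [/\ y \in t, z \in t & x + y + z = 3 * a].
Proof.
case/mem_vertex=> v /vertexP[x1 [x2 [x3 [v_eq [t1 t2 t3] _ _ sum3]]]].
rewrite (perm_mem v_eq) !inE => /or3P[] /eqP ->; [exists x2, x3|exists x1, x3|exists x1, x2];
  split=> //; lra.
Qed.

(** Double counting. The first hypothesis makes the entries of [ls] pairwise distinct up to
    permutation, so each triple is counted under exactly one of them. *)
Lemma class_count (ls : seq (seq R)) (P : pred R) :
  (forall l, l \in ls -> count (perm_eq l) ls = 1%N) ->
  (forall v, v \in vs -> exists2 l, l \in ls & perm_eq v l) ->
  (\sum_(l <- ls) multiplicity vs l * count P l = 12 * count P t)%N.
Proof.
move=> ls1 cover; rewrite -sum_count.
under eq_bigr do rewrite /multiplicity -sum1_count big_mkcond big_distrl.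
rewrite exchange_big big_seq [RHS]big_seq; apply: eq_bigr => v vsv /=.
have [l lsl vl] := cover v vsv.
transitivity (count (perm_eq v) ls * count P v)%N; last first.
  by rewrite (eq_count (_ : perm_eq v =1 perm_eq l)) ?ls1 ?mul1n //; apply/permPl.
rewrite -sum1_count [in RHS]big_mkcond big_distrl; apply: eq_bigr => s _ /=.
by case: ifP => [/seq.permP ->|].
Qed.

End System.

(** * Signs of the angles relative to a *)

Definition below a t : seq R := [seq x <- t | x < a].

Definition above a t : seq R := [seq x <- t | a < x].

Definition signature a (s : seq R) : nat * nat * nat :=
  (count (> a) s, count (< a) s, count_mem a s).

(** The three deviations from [a] add up to zero, so either all vanish or both signs occur. *)
Lemma signatureP a t vs v : angle_system a t vs -> v \in vs ->
  exists x y z, [/\ perm_eq v [:: x; y; z], x <= y, y <= z & x + y + z = 3 * a] /\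
    [\/ signature a v = (0, 0, 3)%N /\ [/\ a \in t, x = a, y = a & z = a],
        signature a v = (1, 1, 1)%N /\
          [/\ a \in t, x \in below a t, y = a & z \in above a t],
        signature a v = (2, 1, 0)%N /\
          [/\ x \in below a t, y \in above a t & z \in above a t] |
        signature a v = (1, 2, 0)%N /\
          [/\ x \in below a t, y \in below a t & z \in above a t]].
Proof.
move=> sys /(vertexP sys)[x [y [z [v_eq [tx ty tz] xy yz sum3]]]].
exists x, y, z; split=> //.
rewrite /signature /below /above !(seq.permP v_eq) /= !mem_filter tx ty tz.
case: (ltgtP x a) => xa; case: (ltgtP y a) => ya; case: (ltgtP z a) => za; try lra.
- by constructor 4.
- by constructor 3.
- by have ta : a \in t by [rewrite -ya]; constructor 2.
- by have ta : a \in t by [rewrite -xa]; constructor 1.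
Qed.

Lemma count_gt_le a t vs : angle_system a t vs ->
  (count (> a) t <= 2 * count (< a) t)%N.
Proof.
move=> sys; rewrite leqNgt; apply/negP => lt_t.
have [|v vsv] := @averaging a t vs sys (< a) pred0 (> a) pred0 2 0 1 0.
  by rewrite mul1n !addn0.
have [? [? [? [_ sig_v]]]] := signatureP sys vsv.
by case: sig_v => -[[-> -> _] _].
Qed.

Lemma count_lt_le a t vs : angle_system a t vs ->
  (count (< a) t <= 2 * count (> a) t)%N.
Proof.
move=> sys; rewrite leqNgt; apply/negP => lt_t.
have [|v vsv] := @averaging a t vs sys (> a) pred0 (< a) pred0 2 0 1 0.
  by rewrite mul1n !addn0.
have [? [? [? [_ sig_v]]]] := signatureP sys vsv.
by case: sig_v => -[[-> -> _] _].
Qed.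

(** Bundled rewrite rules, used to evaluate counts and filters on explicit lists. *)
Lemma lt_tests a x : x < a -> (a < x = false) * (x < a = true) * (x == a = false).
Proof. by move=> xa; rewrite xa (lt_gtF xa) (lt_eqF xa). Qed.

Lemma gt_tests a x : a < x -> (a < x = true) * (x < a = false) * (x == a = false).
Proof. by move=> ax; rewrite ax (lt_gtF ax) (gt_eqF ax). Qed.

(** * No angle equal to a *)

(** The three triples and the sum of [t] are four linear equations for the five deviations from [a].
    In each case of which angles [x], [y], [z], [x2], [x3] are, the solution is fixed up to the
    scale [u] or violates the order. *)
Lemma two_below_three_above_solutions a n2 n1 p1 p2 p3 x y z x2 x3 :
  n2 < n1 -> n1 < a -> a < p1 -> p1 <= p2 -> p2 <= p3 ->
  n2 + n1 + p1 + p2 + p3 = 5 * a ->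
  x \in [:: p1; p2; p3] -> x + 2 * n1 = 3 * a ->
  y \in [:: p1; p2; p3] -> z \in [:: p1; p2; p3] -> y <= z ->
  n1 + y + z = 3 * a ->
  x2 \in [:: p1; p2; p3] -> x3 \in [:: p1; p2; p3] -> x2 <= x3 ->
  n2 + x2 + x3 = 3 * a ->
  exists u, [/\ 0 < u, p1 = a + u, n1 = a - 2 * u &
    [\/ [/\ p2 = a + 4 * u, p3 = a + 5 * u & n2 = a - 8 * u],
        [/\ p2 = a + 2 * u, p3 = a + 4 * u & n2 = a - 5 * u] |
        [/\ p2 = a + 3 * u, p3 = a + 4 * u & n2 = a - 6 * u]]].
Proof.
move=> n21 n1a ap1 p12 p23 sum5 tx x_n1 ty tz yz yz_n1 tx2 tx3 x23 x_n2.
exists (p1 - a); cases_in tx; cases_in tz; cases_in ty; cases_in tx2; cases_in tx3;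
  (split; [lra|lra|lra|]);
  first [by constructor 1; split; lra
        |by constructor 2; split; lra|by constructor 3; split; lra].
Qed.

(** Triples of the forms [(n1, n1, x)], [(n1, y, z)] and [(n2, x2, x3)] are shown to exist, with all
    other entries above [a]. They leave three candidates for [t], and in each some angle cannot be
    used as often as required. *)
Lemma no_two_below_three_above a n2 n1 p1 p2 p3 vs :
  n2 <= n1 -> n1 < a -> a < p1 -> p1 <= p2 -> p2 <= p3 ->
  ~ angle_system a [:: n2; n1; p1; p2; p3] vs.
Proof.
move=> n21 n1a ap1 p12 p23.
have [n2a ap2 ap3] : [/\ n2 < a, a < p2 & a < p3] by split; lra.
set t := [:: _; _; _; _; _] => sys; have := system_sum sys.
rewrite !big_cons big_nil => sum5.
have tests := (lt_tests n2a, lt_tests n1a, gt_tests ap1, gt_tests ap2, gt_tests ap3).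
have [pos_t neg_t] : count (> a) t = 3%N /\ count (< a) t = 2%N.
  by rewrite /= !tests.
have neg_eq : below a t = [:: n2; n1].
  by rewrite /below /= !tests.
have pos_eq : above a t = [:: p1; p2; p3].
  by rewrite /above /= !tests.
have aNt : a \notin t.
  by rewrite !inE !(eq_sym a) !tests.
(* In a triple (-,-,+), an angle n2 would force the angle above a to be too
   large for the sum of t, so both angles below a are n1. *)
have vertex v : v \in vs ->
    (count (> a) v = 2 /\ count (< a) v = 1)%N /\
      (exists x y z, [/\ perm_eq v [:: x; y; z], x \in [:: n2; n1],
         y \in [:: p1; p2; p3], z \in [:: p1; p2; p3] & y <= z /\ x + y + z = 3 * a]) \/
    (count (> a) v = 1 /\ count (< a) v = 2)%N /\
      (exists x, [/\ perm_eq v [:: n1; n1; x], x \in [:: p1; p2; p3],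
         x + 2 * n1 = 3 * a & n2 < n1]).
  case/(signatureP sys)=> x [y [z [[v_eq xy yz sum3]]]].
  rewrite neg_eq pos_eq; case=> -[[-> -> _]].
  - by rewrite (negPf aNt) => -[].
  - by rewrite (negPf aNt) => -[].
  - by case=> tx ty tz; left; split=> //; exists x, y, z.
  - case=> tx ty tz; right; split=> //; exists z.
    have [x1 y1 ltn] : [/\ x = n1, y = n1 & n2 < n1].
      by clear - n21 n1a ap1 p12 p23 sum5 tx ty tz xy sum3;
        cases_in tx; cases_in ty; cases_in tz; split; lra.
    by split=> //; [rewrite (permPl v_eq) x1 y1|lra].
(* Otherwise all triples would be (-,+,+), and t would have twice as many
   angles above a as below. *)
have [x [tx x_n1 ltn]] :
    exists x, [/\ x \in [:: p1; p2; p3], x + 2 * n1 = 3 * a & n2 < n1].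
  have [|v vsv] := @averaging a t vs sys (> a) pred0 (< a) pred0 1 0 2 0.
    by rewrite pos_t neg_t.
  by case: (vertex v vsv) => -[[-> ->]] // [x [_ ? ? ?]]; exists x.
have [y [z [ty tz yz yz_n1]]] :
    exists y z, [/\ y \in [:: p1; p2; p3], z \in [:: p1; p2; p3], y <= z &
                    n1 + y + z = 3 * a].
  (* 4 #below - 2 #above is 2 for t, 6 for (n1,n1,x) and 0 for (-,+,+), so the
     four triples (n1,n1,x) do not use up all twelve n1. *)
  have neq_n1 w : w \in [:: p1; p2; p3] -> (w == n1) = false.
    by rewrite !inE => /or3P[] /eqP->; rewrite gt_eqF // (lt_trans n1a).
  have [|v vsv] := @averaging a t vs sys (< a) pred0 (> a) (pred1 n1) 4 0 2 3.
    by rewrite pos_t neg_t /= eqxx (lt_eqF ltn) !neq_n1 ?inE ?eqxx ?orbT.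
  case: (vertex v vsv) => -[[-> ->]].
    case=> x1 [y1 [z1 [v_eq _ ty1 tz1 [yz1 sum3]]]].
    rewrite !(seq.permP v_eq) /= (neq_n1 _ ty1) (neq_n1 _ tz1).
    by have [<- _|//] := eqVneq x1 n1; exists y1, z1.
  by case=> x1 [v_eq tx1 _ _]; rewrite !(seq.permP v_eq) /= eqxx (neq_n1 _ tx1).
have n2_vertex v : v \in vs -> n2 \in v -> exists x2 x3,
    [/\ perm_eq v [:: n2; x2; x3], x2 \in [:: p1; p2; p3], x3 \in [:: p1; p2; p3],
        x2 <= x3 & n2 + x2 + x3 = 3 * a].
  have n2_neq w : w \in [:: p1; p2; p3] -> (n2 == w) = false.
    by rewrite !inE => /or3P[] /eqP->; rewrite lt_eqF // (lt_trans n2a).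
  move=> vsv; case: (vertex v vsv) => -[_].
    case=> x1 [y1 [z1 [v_eq _ ty1 tz1 [yz1 sum3]]]].
    rewrite (perm_mem v_eq) !inE (n2_neq _ ty1) (n2_neq _ tz1) !orbF => /eqP n2x1.
    by exists y1, z1; rewrite n2x1.
  case=> x1 [v_eq tx1 _ _].
  by rewrite (perm_mem v_eq) !inE (n2_neq _ tx1) (lt_eqF ltn).
have [v vsv n2v] := mem_vertex sys (mem_head _ _ : n2 \in t).
have [x2 [x3 [_ tx2 tx3 x23 x_n2]]] := n2_vertex v vsv n2v.
have sum5' : n2 + n1 + p1 + p2 + p3 = 5 * a by rewrite -sum5 !addrA addr0.
have [u [u_gt0 def_p1 def_n1 sol]] := two_below_three_above_solutions ltn n1a ap1 p12 p23
  sum5' tx x_n1 ty tz yz yz_n1 tx2 tx3 x23 x_n2.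
clear - sys sol u_gt0 def_p1 def_n1 n2_vertex sum5.
case: sol => -[def_p2 def_p3 def_n2].
- have [|y [z [ty tz sum3]]] := @mates a t vs sys p3.
    by rewrite !inE eqxx !orbT.
  by cases_in ty; cases_in tz.
- have [|y [z [ty tz sum3]]] := @mates a t vs sys p2.
    by rewrite !inE eqxx !orbT.
  by cases_in ty; cases_in tz.
- (* Here n2 only occurs in (n2,p2,p2), which would use p2 too often. *)
  have [n1p2 p1p2 p2p3] : [/\ n1 < p2, p1 < p2 & p2 < p3] by split; lra.
  have [n2n1 n2p1 n2p2 n2p3] : [/\ n2 < n1, n2 < p1, n2 < p2 & n2 < p3] by split; lra.
  have [|v vsv] := @averaging a t vs sys (pred1 p2) pred0 (pred1 n2) pred0 1 0 2 0.
    by rewrite /= !eqxx (lt_eqF n2p2) (lt_eqF n1p2) (lt_eqF p1p2) (gt_eqF p2p3)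
      (gt_eqF n2n1) (gt_eqF n2p1) (gt_eqF n2p2) (gt_eqF n2p3).
  have [n2v|] := boolP (n2 \in v); last first.
    by move/count_memPn => ->.
  have [x2 [x3 [v_eq tx2 tx3 _ sum3]]] := n2_vertex v vsv n2v.
  have x2p2 : x2 = p2 by cases_in tx2; cases_in tx3.
  have x3p2 : x3 = p2 by lra.
  by rewrite !(seq.permP v_eq) x2p2 x3p2 /= !eqxx (lt_eqF n2p2) (gt_eqF n2p2).
Qed.

(** * The possible combinations *)

Definition classified a t vs : Prop :=
  [\/ perm_eq t [:: a; a; a; a; a] /\
      vertex_counts vs [:: (20%N, [:: a; a; a])],
      exists b c : R,
        [/\ uniq [:: a; b; c],
            perm_eq t [:: a; a; a; b; c],
            b + c = 2 * a &
            vertex_counts vs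
              [:: (8%N, [:: a; a; a]); (12%N, [:: a; b; c])]],
      exists b c : R,
        [/\ uniq [:: a; b; c],
            perm_eq t [:: a; a; b; b; c],
            2 * b + c = 3 * a &
            vertex_counts vs
              [:: (8%N, [:: a; a; a]); (12%N, [:: b; b; c])]] |
      (exists b c d : R,
        [/\ uniq [:: a; b; c; d],
            perm_eq t [:: a; a; b; c; d],
            b + c + d = 3 * a &
            vertex_counts vs
              [:: (8%N, [:: a; a; a]); (12%N, [:: b; c; d])]]) \/
      (exists b c d e : R,
        [/\ uniq [:: a; b; c; d; e],
            perm_eq t [:: a; b; c; d; e],
            [/\ c = 3 * a - 2 * b, d = 2 * a - b & e = 2 * b - a] &
            [\/ vertex_counts vs
                  [:: (4%N, [:: a; b; d]); (8%N, [:: a; c; e]);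
                      (4%N, [:: b; b; c]); (4%N, [:: d; d; e])],
                vertex_counts vs
                  [:: (1%N, [:: a; a; a]); (2%N, [:: a; b; d]);
                      (7%N, [:: a; c; e]); (5%N, [:: b; b; c]);
                      (5%N, [:: d; d; e])] |
                vertex_counts vs
                  [:: (2%N, [:: a; a; a]); (6%N, [:: a; c; e]);
                      (6%N, [:: b; b; c]); (6%N, [:: d; d; e])]]])].

Lemma vertex_counts_classes vs (ls : seq (seq R)) :
  (forall v, v \in vs -> exists2 l, l \in ls & perm_eq v l) ->
  vertex_counts vs [seq (multiplicity vs l, l) | l <- ls].
Proof.
move=> cover; split=> [_ /mapP[l _ ->] //|v /cover[l lsl vl]].
by exists (multiplicity vs l, l) => //; apply/mapP; exists l.
Qed.

(** Two of the solutions of [progression_counts] give multiplicity zero to a class, which the final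
    lists omit. *)
Lemma vertex_counts_nonzero vs l :
  vertex_counts vs l -> vertex_counts vs [seq p <- l | p.1 != 0%N].
Proof.
case=> counts cover; split=> [p|v vsv]; first by rewrite mem_filter => /andP[_ /counts].
have [p lp vp] := cover v vsv; exists p => //; rewrite mem_filter lp andbT.
rewrite -(counts p lp) -lt0n -has_count; apply/hasP; by exists v.
Qed.

Lemma classified_perm a t t' vs :
  perm_eq t t' -> classified a t vs -> classified a t' vs.
Proof.
move=> /permPl tt'; case=> [[pt vc]|[b [c [bc pt eq_a vc]]]|[b [c [bc pt eq_a vc]]]|].
- by constructor 1; rewrite -tt'.
- by constructor 2; exists b, c; rewrite -tt'.
- by constructor 3; exists b, c; rewrite -tt'.
case=> [[b [c [d [bcd pt eq_a vc]]]]|[b [c [d [e [bcde pt eq_a vc]]]]]].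
  by constructor 4; left; exists b, c, d; rewrite -tt'.
by constructor 4; right; exists b, c, d, e; rewrite -tt'.
Qed.

(** * At least two angles equal to a *)

Lemma classified_const a vs :
  angle_system a [:: a; a; a; a; a] vs -> classified a [:: a; a; a; a; a] vs.
Proof.
move=> sys; constructor 1; split=> //.
have cover v : v \in vs -> exists2 l, l \in [:: [:: a; a; a]] & perm_eq v l.
  move=> /(vertexP sys)[x [y [z [v_eq [tx ty tz] _ _ _]]]].
  exists [:: a; a; a]; rewrite ?mem_head //.
  by move: tx ty tz v_eq; rewrite !inE !orbb => /eqP-> /eqP-> /eqP->.
have vc := vertex_counts_classes cover.
have distinct l : l \in [:: [:: a; a; a]] -> count (perm_eq l) [:: [:: a; a; a]] = 1%N.
  by rewrite inE => /eqP->; rewrite /= perm_refl.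
have := class_count sys predT distinct cover; rewrite big_seq1 /= => eq60.
have E : multiplicity vs [:: a; a; a] = 20%N by lia.
by move: vc; rewrite /= E.
Qed.

(** Here [n + p = 2 * a], so [n + 2 * p] exceeds [3 * a] and [2 * n + p] stays below it: no triple
    has two angles on the same side of [a]. *)
Lemma classified_three a n p vs : n < a -> a < p ->
  angle_system a [:: n; a; a; a; p] vs -> classified a [:: n; a; a; a; p] vs.
Proof.
move=> na ap sys; have := system_sum sys; rewrite !big_cons big_nil => sum5.
have np : n < p by lra.
have tests := (lt_tests na, gt_tests ap, lt_eqF np, gt_eqF np, gt_eqF na, lt_eqF ap).
have neg_eq : below a [:: n; a; a; a; p] = [:: n].
  by rewrite /below /= !(ltxx, tests).
have pos_eq : above a [:: n; a; a; a; p] = [:: p].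
  by rewrite /above /= !(ltxx, tests).
set ls := [:: [:: a; a; a]; [:: a; n; p]].
have cover v : v \in vs -> exists2 l, l \in ls & perm_eq v l.
  case/(signatureP sys)=> x [y [z [[v_eq xy yz sum3]]]]; rewrite neg_eq pos_eq.
  case=> -[_ []].
  - move=> _ xa ya za; exists [:: a; a; a]; first by rewrite !inE eqxx.
    by rewrite xa ya za in v_eq.
  - rewrite !inE => _ /eqP xn ya /eqP zp; exists [:: a; n; p].
      by rewrite !inE eqxx orbT.
    by rewrite (permPl v_eq) xn ya zp; perm_cases.
  - by move=> tx ty tz; exfalso; cases_in tx; cases_in ty; cases_in tz.
  - by move=> tx ty tz; exfalso; cases_in tx; cases_in ty; cases_in tz.
have distinct l : l \in ls -> count (perm_eq l) ls = 1%N.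
  by rewrite !inE => /orP[] /eqP->; rewrite /perm_eq /= !(eqxx, tests).
have := class_count sys (pred1 n) distinct cover.
have := class_count sys (pred1 a) distinct cover.
have := vertex_counts_classes cover.
rewrite /ls !big_cons !big_nil /= !(eqxx, tests) /=.
set m := multiplicity vs [:: a; a; a]; set k := multiplicity vs [:: a; n; p] => counts eq_a eq_n.
(* Counting [n] gives k = 12, and counting [a] gives 3m + k = 36. *)
have E1 : m = 8%N by lia.
have E2 : k = 12%N by lia.
rewrite E1 E2 in counts.
constructor 2; exists n, p; split=> //.
- by rewrite /= !inE !tests.
- by perm_cases.
- lra.
Qed.

(** Common end of the two patterns with exactly two angles [a]: [d] is alone on its side, while [b]
    and [c] may coincide, which separates the third combination from the fourth. *)
Lemma classified_two a b c d vs : b != a -> c != a -> d != a -> b != d -> c != d ->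
  (forall v, v \in vs -> exists2 l, l \in [:: [:: a; a; a]; [:: b; c; d]] & perm_eq v l) ->
  angle_system a [:: a; a; b; c; d] vs -> classified a [:: a; a; b; c; d] vs.
Proof.
move=> ba ca da bd cd; set ls := [:: [:: a; a; a]; _] => cover sys.
have sum5 := system_sum sys; rewrite !big_cons big_nil in sum5.
have tests := (negPf ba, negPf ca, negPf da, negPf bd, negPf cd,
  (eq_sym a b, eq_sym a c, eq_sym a d, eq_sym d b, eq_sym d c)).
have distinct l : l \in ls -> count (perm_eq l) ls = 1%N.
  rewrite !inE => /orP[] /eqP->; rewrite /= !perm_refl ?[perm_eq [:: b; c; d] _]perm_sym.
    by rewrite /perm_eq /= !(eqxx, tests).
  by rewrite /perm_eq /= !(eqxx, tests).
have := class_count sys predT distinct cover.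
have := class_count sys (pred1 a) distinct cover.
have := vertex_counts_classes cover.
rewrite /ls !big_cons !big_nil /= !(eqxx, tests) /=.
set m := multiplicity vs [:: a; a; a]; set k := multiplicity vs [:: b; c; d] => counts eq_a eq_T.
(* Counting [a] gives 3m = 24. Counting all angles gives 3m + 3k = 60, whether or not [b] equals
   [c]. *)
have E1 : m = 8%N by lia.
have E2 : k = 12%N by lia.
rewrite E1 E2 in counts.
have [eq_bc|neq_bc] := eqVneq b c; last first.
  constructor 4; left; exists b, c, d; split=> //; last lra.
  by rewrite /= !inE (negPf neq_bc) !tests.
rewrite -eq_bc in counts sum5 *.
constructor 3; exists b, d; split=> //; last lra.
by rewrite /= !inE !tests.
Qed.

(** As [n + p1 + p2 = 3 * a], triples of signs (-,0,+) or (-,-,+) have too small a sum, and taking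
    one of [p1], [p2] twice is possible only if they are equal. *)
Lemma classified_two_above a n p1 p2 vs : n < a -> a < p1 -> p1 <= p2 ->
  angle_system a [:: a; a; p1; p2; n] vs -> classified a [:: a; a; p1; p2; n] vs.
Proof.
move=> na ap1 p12 sys; have := system_sum sys; rewrite !big_cons big_nil => sum5.
have [ap2 np1 np2] : [/\ a < p2, n < p1 & n < p2] by split; lra.
have tests := (lt_tests na, gt_tests ap1, gt_tests ap2).
have neg_eq : below a [:: a; a; p1; p2; n] = [:: n].
  by rewrite /below /= !(ltxx, tests).
have pos_eq : above a [:: a; a; p1; p2; n] = [:: p1; p2].
  by rewrite /above /= !(ltxx, tests).
apply: classified_two => //;
  rewrite ?(gt_eqF ap1, gt_eqF ap2, gt_eqF np1, gt_eqF np2, lt_eqF na) //.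
move=> v /(signatureP sys)[x [y [z [[v_eq xy yz sum3]]]]]; rewrite neg_eq pos_eq.
case=> -[_ []].
- move=> _ xa ya za; exists [:: a; a; a]; first by rewrite !inE eqxx.
  by rewrite xa ya za in v_eq.
- by move=> _ tx ya tz; exfalso; cases_in tx; cases_in tz.
- move=> tx ty tz; exists [:: p1; p2; n]; first by rewrite !inE eqxx orbT.
  have [xn y1 z2] : [/\ x = n, y = p1 & z = p2].
    by cases_in tx; cases_in ty; cases_in tz; split; lra.
  by rewrite (permPl v_eq) xn y1 z2; perm_cases.
- by move=> tx ty tz; exfalso; cases_in tx; cases_in ty; cases_in tz.
Qed.

(** Mirror image of [classified_two_above]: the excluded sums are now too large. *)
Lemma classified_two_below a n1 n2 p vs : n1 <= n2 -> n2 < a -> a < p ->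
  angle_system a [:: a; a; n1; n2; p] vs -> classified a [:: a; a; n1; n2; p] vs.
Proof.
move=> n12 n2a ap sys; have := system_sum sys; rewrite !big_cons big_nil => sum5.
have [n1a n1p n2p] : [/\ n1 < a, n1 < p & n2 < p] by split; lra.
have tests := (lt_tests n1a, lt_tests n2a, gt_tests ap).
have neg_eq : below a [:: a; a; n1; n2; p] = [:: n1; n2].
  by rewrite /below /= !(ltxx, tests).
have pos_eq : above a [:: a; a; n1; n2; p] = [:: p].
  by rewrite /above /= !(ltxx, tests).
apply: classified_two => //;
  rewrite ?(lt_eqF n1a, lt_eqF n2a, lt_eqF n1p, lt_eqF n2p, gt_eqF ap) //.
move=> v /(signatureP sys)[x [y [z [[v_eq xy yz sum3]]]]]; rewrite neg_eq pos_eq.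
case=> -[_ []].
- move=> _ xa ya za; exists [:: a; a; a]; first by rewrite !inE eqxx.
  by rewrite xa ya za in v_eq.
- by move=> _ tx ya tz; exfalso; cases_in tx; cases_in tz.
- by move=> tx ty tz; exfalso; cases_in tx; cases_in ty; cases_in tz.
- move=> tx ty tz; exists [:: n1; n2; p]; first by rewrite !inE eqxx orbT.
  have [x1 y2 zp] : [/\ x = n1, y = n2 & z = p].
    by cases_in tx; cases_in ty; cases_in tz; split; lra.
  by rewrite (permPl v_eq) x1 y2 zp.
Qed.

(** * Exactly one angle equal to a *)

(** A triple (-,+,+), a triple (-,-,+) and the sum are three equations for four deviations. Up to
    scale three solutions respect the order, and the last two are mirror images. *)
Lemma two_below_two_above_solutions a n2 n1 p1 p2 x y z x' y' z' :
  n2 <= n1 -> n1 < a -> a < p1 -> p1 <= p2 -> n2 + n1 + p1 + p2 = 4 * a ->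
  x \in [:: n2; n1] -> y \in [:: p1; p2] -> z \in [:: p1; p2] -> y <= z ->
  x + y + z = 3 * a ->
  x' \in [:: n2; n1] -> y' \in [:: n2; n1] -> z' \in [:: p1; p2] -> x' <= y' ->
  x' + y' + z' = 3 * a ->
  exists u, 0 < u /\
    [\/ [/\ n2 = a - 2 * u, n1 = a - u, p1 = a + u & p2 = a + 2 * u],
        [/\ n2 = a - 3 * u, n1 = a - 2 * u, p1 = a + u & p2 = a + 4 * u] |
        [/\ n2 = a - 4 * u, n1 = a - u, p1 = a + 2 * u & p2 = a + 3 * u]].
Proof.
move=> n21 n1a ap1 p12 sum4 tx ty tz yz sum3 tx' ty' tz' xy' sum3'.
cases_in tx; cases_in tz; cases_in ty; cases_in ty'; cases_in tx'; cases_in tz';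
  first [exists (p1 - a); split; [lra|]; constructor 1; split; lra
        |exists (p1 - a); split; [lra|]; constructor 2; split; lra
        |exists (a - n1); split; [lra|]; constructor 3; split; lra].
Qed.

(** The solutions form a line with parameter [m4]: m1 = m4 - 4, m2 = 12 - 2 m4, m3 = 12 - m4 and m5
    = m4. Nonnegativity of m1 and m2 confines [m4] to 4, 5, 6. *)
Lemma progression_counts m1 m2 m3 m4 m5 :
  (3 * m1 + m2 + m3 = 12 -> m2 + 2 * m4 = 12 -> m3 + m4 = 12 ->
   m2 + 2 * m5 = 12 -> m3 + m5 = 12 ->
   [\/ [/\ m1 = 0, m2 = 4, m3 = 8, m4 = 4 & m5 = 4],
       [/\ m1 = 1, m2 = 2, m3 = 7, m4 = 5 & m5 = 5] |
       [/\ m1 = 2, m2 = 0, m3 = 6, m4 = 6 & m5 = 6]])%N.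
Proof.
move=> eq_a eq_b eq_c eq_d eq_e; have : (4 <= m4 <= 6)%N by lia.
case/andP=> le4; rewrite leq_eqVlt => /orP[/eqP m46|].
  by constructor 3; split; lia.
rewrite ltnS leq_eqVlt => /orP[/eqP m45|lt5].
  by constructor 2; split; lia.
by constructor 1; split; lia.
Qed.

(** In units of [u] the deviations from [a] are 0, 1, -2, -1, 2. Exactly five multisets of three of
    them have sum zero, and these are the classes in [ls]. *)
Lemma classified_one_progression a u b c d e vs : 0 < u ->
  b = a + u -> c = a - 2 * u -> d = a - u -> e = a + 2 * u ->
  angle_system a [:: a; b; c; d; e] vs -> classified a [:: a; b; c; d; e] vs.
Proof.
move=> u_gt0 def_b def_c def_d def_e sys.
have [ab ae da ca] : [/\ a < b, a < e, d < a & c < a] by split; lra.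
have [cd be cb] : [/\ c < d, b < e & c < b] by split; lra.
have [db ce de] : [/\ d < b, c < e & d < e] by split; lra.
have signs := (gt_tests ab, gt_tests ae, lt_tests da, lt_tests ca).
have tests := ((lt_eqF ab, gt_eqF ab, lt_eqF ae, gt_eqF ae),
  (lt_eqF da, gt_eqF da, lt_eqF ca, gt_eqF ca),
  (lt_eqF cd, gt_eqF cd, lt_eqF be, gt_eqF be, lt_eqF cb, gt_eqF cb),
  (lt_eqF db, gt_eqF db, lt_eqF ce, gt_eqF ce, lt_eqF de, gt_eqF de)).
have neg_eq : below a [:: a; b; c; d; e] = [:: c; d].
  by rewrite /below /= !(ltxx, signs).
have pos_eq : above a [:: a; b; c; d; e] = [:: b; e].
  by rewrite /above /= !(ltxx, signs).
set ls := [:: [:: a; a; a]; [:: a; b; d]; [:: a; c; e]; [:: b; b; c]; [:: d; d; e]].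
have cover v : v \in vs -> exists2 l, l \in ls & perm_eq v l.
  case/(signatureP sys)=> x [y [z [[v_eq xy yz sum3]]]]; rewrite neg_eq pos_eq.
  case=> -[_ []].
  - move=> _ xa ya za; exists [:: a; a; a]; first by rewrite !inE eqxx.
    by rewrite xa ya za in v_eq.
  - move=> _ tx ya tz; cases_in tx; cases_in tz.
      exists [:: a; c; e]; first by rewrite !inE eqxx !orbT.
      by rewrite (permPl v_eq) tx ya tz; perm_cases.
    exists [:: a; b; d]; first by rewrite !inE eqxx !orbT.
    by rewrite (permPl v_eq) tx ya tz; perm_cases.
  - move=> tx ty tz; exists [:: b; b; c]; first by rewrite !inE eqxx !orbT.
    have [xc yb zb] : [/\ x = c, y = b & z = b].
      by cases_in tx; cases_in ty; cases_in tz; split; lra.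
    by rewrite (permPl v_eq) xc yb zb; perm_cases.
  - move=> tx ty tz; exists [:: d; d; e]; first by rewrite !inE eqxx !orbT.
    have [xd yd ze] : [/\ x = d, y = d & z = e].
      by cases_in tx; cases_in ty; cases_in tz; split; lra.
    by rewrite (permPl v_eq) xd yd ze; perm_cases.
have distinct l : l \in ls -> count (perm_eq l) ls = 1%N.
  by rewrite !inE => /or4P[/eqP->|/eqP->|/eqP->|/orP[] /eqP->];
    rewrite /perm_eq /= !(eqxx, tests).
have := vertex_counts_classes cover.
have := class_count sys (pred1 a) distinct cover.
have := class_count sys (pred1 b) distinct cover.
have := class_count sys (pred1 c) distinct cover.
have := class_count sys (pred1 d) distinct cover.
have := class_count sys (pred1 e) distinct cover.
rewrite /ls !big_cons !big_nil /= !(eqxx, tests) /=.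
set m1 := multiplicity vs [:: a; a; a]; set m2 := multiplicity vs [:: a; b; d].
set m3 := multiplicity vs [:: a; c; e]; set m4 := multiplicity vs [:: b; b; c].
set m5 := multiplicity vs [:: d; d; e].
move=> eq_e eq_d eq_c eq_b eq_a counts.
constructor 4; right; exists b, c, d, e; split=> //.
- by rewrite /= !inE !tests.
- by split; lra.
have sol := @progression_counts m1 m2 m3 m4 m5.
case: sol; [clear - eq_a; lia|clear - eq_b; lia|clear - eq_c; lia
  |clear - eq_d; lia|clear - eq_e; lia| | |];
move=> [m1E m2E m3E m4E m5E]; rewrite m1E m2E m3E m4E m5E in counts.
- by constructor 1; apply: vertex_counts_nonzero counts.
- by constructor 2.
- by constructor 3; apply: vertex_counts_nonzero counts.
Qed.

Lemma classified_one a n2 n1 p1 p2 vs :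
  n2 <= n1 -> n1 < a -> a < p1 -> p1 <= p2 ->
  angle_system a [:: n2; n1; a; p1; p2] vs ->
  classified a [:: n2; n1; a; p1; p2] vs.
Proof.
move=> n21 n1a ap1 p12; set t := [:: _; _; _; _; _] => sys.
have := system_sum sys; rewrite !big_cons big_nil => sum5.
have [n2a ap2] : n2 < a /\ a < p2 by split; lra.
have tests := (lt_tests n1a, lt_tests n2a, gt_tests ap1, gt_tests ap2).
have neg_eq : below a t = [:: n2; n1] by rewrite /below /= !(ltxx, tests).
have pos_eq : above a t = [:: p1; p2] by rewrite /above /= !(ltxx, tests).
have [x [y [z [tx ty tz yz sum3]]]] : exists x y z, [/\ x \in [:: n2; n1],
    y \in [:: p1; p2], z \in [:: p1; p2], y <= z & x + y + z = 3 * a].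
  (* For [t] the inequality reads 2 + 1 < 4. Among the four signatures of a triple only (-,+,+)
     satisfies it; the mirrored weights below single out (-,-,+). *)
  have [|v vsv] := @averaging a t vs sys (< a) (pred1 a) (> a) pred0 1 1 2 0.
    by rewrite /= !(eqxx, ltxx, tests).
  have [x [y [z [[_ xy yz sum3]]]]] := signatureP sys vsv.
  rewrite neg_eq pos_eq; case=> -[[-> -> ->] []] // tx ty tz _.
  by exists x, y, z.
have [x' [y' [z' [tx' ty' tz' xy' sum3']]]] : exists x y z, [/\ x \in [:: n2; n1],
    y \in [:: n2; n1], z \in [:: p1; p2], x <= y & x + y + z = 3 * a].
  have [|v vsv] := @averaging a t vs sys (> a) (pred1 a) (< a) pred0 1 1 2 0.
    by rewrite /= !(eqxx, ltxx, tests).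
  have [x' [y' [z' [[_ xy' yz' sum3']]]]] := signatureP sys vsv.
  rewrite neg_eq pos_eq; case=> -[[-> -> ->] []] // tx' ty' tz' _.
  by exists x', y', z'.
have sum4 : n2 + n1 + p1 + p2 = 4 * a by lra.
have [u [u_gt0 sol]] := two_below_two_above_solutions n21 n1a ap1 p12 sum4
  tx ty tz yz sum3 tx' ty' tz' xy' sum3'.
clear - sys sol u_gt0; case: sol => -[def_n2 def_n1 def_p1 def_p2].
- have t_perm : perm_eq t [:: a; p1; n2; n1; p2] by rewrite /t; perm_cases.
  have := angle_system_perm t_perm sys => /classified_one_progression.
  move=> /(_ u u_gt0 def_p1 def_n2 def_n1 def_p2).
  by apply: classified_perm; rewrite perm_sym.
(* With deviations -3, -2, 0, 1, 4 no two angles complete [n2]; in the mirrored case none complete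
   [p2]. *)
- have [|y [z [ty tz sum3]]] := @mates a t vs sys n2.
    by rewrite inE eqxx.
  by exfalso; cases_in ty; cases_in tz.
- have [|y [z [ty tz sum3]]] := @mates a t vs sys p2.
    by rewrite !inE eqxx !orbT.
  by exfalso; cases_in ty; cases_in tz.
Qed.

(** * Putting the cases together *)

Lemma classify_perm a t t' vs : perm_eq t' t ->
  (angle_system a t' vs -> classified a t' vs) ->
  angle_system a t vs -> classified a t vs.
Proof.
move=> tt' classify sys; apply: (classified_perm tt'); apply: classify.
by apply: (angle_system_perm _ sys); rewrite perm_sym.
Qed.

Lemma classify a t vs : angle_system a t vs -> classified a t vs.
Proof.
apply: (@classify_perm a t (sort <=%R t)) => [|sys]; first by rewrite perm_sort.
have [size_t _ _] := sys; have := sort_le_sorted t.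
move: (sort _ _) size_t sys => {}t.
case: t => [|t1 [|t2 [|t3 [|t4 [|t5 [|? ?]]]]]] //= _ sys /and5P[le12 le23 le34 le45 _].
have := system_sum sys; rewrite !big_cons big_nil => sum5.
move: (count_gt_le sys) (count_lt_le sys) => /=.
(* Seven sign patterns of the sorted [t] are compatible with its sum and with the two bounds on the
   numbers of angles below and above [a]. *)
case: (ltgtP t1 a) => h1; case: (ltgtP t2 a) => h2; try (exfalso; lra);
case: (ltgtP t3 a) => h3; try (exfalso; lra);
case: (ltgtP t4 a) => h4; try (exfalso; lra);
case: (ltgtP t5 a) => h5; try (exfalso; lra); try by [].
- move=> _ _; exfalso; have := angle_system_opp sys.
  have perm_opp : perm_eq [seq - x | x <- [:: t1; t2; t3; t4; t5]]
      [:: - t5; - t4; - t3; - t2; - t1] by perm_cases.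
  by move/(angle_system_perm perm_opp); apply: no_two_below_three_above; lra.
- by move=> _ _; exfalso; move: sys; apply: no_two_below_three_above.
- by move=> _ _; rewrite h3 in sys *; apply: classified_one.
- move=> _ _; rewrite h3 h4 in sys *; move: sys.
  apply: (@classify_perm a _ [:: a; a; t1; t2; t5]); first by perm_cases.
  exact: classified_two_below.
- move=> _ _; rewrite h2 h3 in sys *; move: sys.
  apply: (@classify_perm a _ [:: a; a; t4; t5; t1]); first by perm_cases.
  exact: classified_two_above.
- by move=> _ _; rewrite h2 h3 h4 in sys *; apply: classified_three.
- by move=> _ _; rewrite h1 h2 h3 h4 h5 in sys *; apply: classified_const.
Qed.
End AngleSystems.

(** * Tilings *)

Section Final.
Variables (R : realType) (T : spherical_tiling R) (a : R).
Hypotheses (ha : a = 2 / 3 * pi)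
    (tiles12 : #|tiles T| = 12%N)
    (pentagons : forall F, F \in tiles T -> pentagon F)
    (congruent : forall F G, F \in tiles T -> G \in tiles T ->
       angle_congruent F G).

Definition vertex_angles : seq (seq R) :=
  [seq [seq angle x | x <- enum V] | V : {set dart T} <- enum (vertices T)].

Let card_tile F : F \in tiles T -> #|F| = 5%N.
Proof. by case/pentagons. Qed.

(** The angle sum [2 * pi] at a vertex is [3 * a]. Grouping all darts by vertices or by tiles counts
    the same angles, and by congruence each of the 12 tiles contributes the multiset of [F]. *)
Lemma tiling_angle_system (F : {set dart T}) : F \in tiles T ->
  angle_system a [seq angle x | x <- enum F] vertex_angles.
Proof.
move=> tileF; split; first by rewrite size_map -cardE card_tile.
  move=> v /mapP[V + ->]; rewrite mem_enum => vertV.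
  rewrite size_map -cardE degree_3 // big_map big_enum angle_sum // ha.
  by split=> //; lra.
apply/seq.permP => P; rewrite !count_flatten map_nseq sumn_nseq.
rewrite sumnE !big_map big_enum /=; under eq_bigr do rewrite count_map_enum.
rewrite (sum_porbits (Defs.rot T) (fun x => P (angle x) : nat)).
rewrite -(sum_porbits (Defs.next T) (fun x => P (angle x) : nat)) -/(tiles T).
rewrite mulnC -tiles12 -sum_nat_const; apply: eq_bigr => G tileG.
rewrite -count_map_enum; apply/seq.permP.
by apply: angle_congruent_perm; rewrite ?card_tile //; apply: congruent.
Qed.

Lemma vertex_combination_counts l :
  vertex_counts vertex_angles l -> vertex_combination T l.
Proof.
case=> counts cover; split=> [p /counts <-|V vertV].
  rewrite /multiplicity /vertex_angles count_map -sum1_count big_enum_cond /=.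
  by rewrite sum1dep_card; apply: eq_card => V; rewrite !inE.
have [|p lp Vp] := cover [seq angle x | x <- enum V]; last by exists p.
by apply/mapP; exists V; rewrite ?mem_enum.
Qed.

Lemma tile_angles_perm F s : F \in tiles T ->
  perm_eq [seq angle x | x <- enum F] s -> tile_angles T s.
Proof.
move=> tileF Fs G tileG; rewrite /has_angles -(permPr Fs).
by apply: angle_congruent_perm; rewrite ?card_tile //; apply: congruent.
Qed.
End Final.

Theorem proposition17 (R : realType) (T : spherical_tiling R) (a : R)
    (ha : a = 2 / 3 * pi)
    (tiles12 : #|tiles T| = 12%N)
    (pentagons : forall F, F \in tiles T -> pentagon F)
    (congruent : forall F G, F \in tiles T -> G \in tiles T ->
       angle_congruent F G) :
  [\/ tile_angles T [:: a; a; a; a; a] /\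
      vertex_combination T [:: (20%N, [:: a; a; a])],
      exists b c : R,
        [/\ uniq [:: a; b; c],
            tile_angles T [:: a; a; a; b; c],
            b + c = 2 * a &
            vertex_combination T
              [:: (8%N, [:: a; a; a]); (12%N, [:: a; b; c])]],
      exists b c : R,
        [/\ uniq [:: a; b; c],
            tile_angles T [:: a; a; b; b; c],
            2 * b + c = 3 * a &
            vertex_combination T
              [:: (8%N, [:: a; a; a]); (12%N, [:: b; b; c])]] |
      (exists b c d : R,
        [/\ uniq [:: a; b; c; d],
            tile_angles T [:: a; a; b; c; d],
            b + c + d = 3 * a &
            vertex_combination T
              [:: (8%N, [:: a; a; a]); (12%N, [:: b; c; d])]]) \/
      (exists b c d e : R,
        [/\ uniq [:: a; b; c; d; e],
            tile_angles T [:: a; b; c; d; e],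
            [/\ c = 3 * a - 2 * b, d = 2 * a - b & e = 2 * b - a] &
            [\/ vertex_combination T
                  [:: (4%N, [:: a; b; d]); (8%N, [:: a; c; e]);
                      (4%N, [:: b; b; c]); (4%N, [:: d; d; e])],
                vertex_combination T
                  [:: (1%N, [:: a; a; a]); (2%N, [:: a; b; d]);
                      (7%N, [:: a; c; e]); (5%N, [:: b; b; c]);
                      (5%N, [:: d; d; e])] |
                vertex_combination T
                  [:: (2%N, [:: a; a; a]); (6%N, [:: a; c; e]);
                      (6%N, [:: b; b; c]); (6%N, [:: d; d; e])]]])].
Proof.
have [F tileF] : exists F, F \in tiles T.
  by apply/set0Pn; rewrite -card_gt0 tiles12.
have sys := tiling_angle_system ha tiles12 pentagons congruent tileF.
have tile_eq s := tile_angles_perm pentagons congruent tileF (s := s).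
have vertex_eq l := vertex_combination_counts (T := T) (l := l).
case: (classify sys) => [[/tile_eq tile_s /vertex_eq counts]
  |[b [c [bc /tile_eq tile_s eq_a /vertex_eq counts]]]
  |[b [c [bc /tile_eq tile_s eq_a /vertex_eq counts]]]
  |[[b [c [d [bcd /tile_eq tile_s eq_a /vertex_eq counts]]]]
   |[b [c [d [e [bcde /tile_eq tile_s eq_a counts]]]]]]].
- by constructor 1.
- by constructor 2; exists b, c.
- by constructor 3; exists b, c.
- by constructor 4; left; exists b, c, d.
- constructor 4; right; exists b, c, d, e; split=> //.
  by case: counts => /vertex_eq counts; [constructor 1|constructor 2|constructor 3].
Qed.
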